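(* Fix $\alpha$ with $$0<\alpha\le\frac{\sqrt5-1}{2}.$$ For every integer $N\ge1$, every $p\in(0,1)$, and every random set $J\subseteq[N]$ whose law is $\alpha p$-spread, if $X_\alpha\sim\mu_\alpha$ is independent of $J$, then $$J\cap X_\alpha\le_d X_p,$$ where $X_p$ denotes a random set of law $\mu_p$; that is, there exists a coupling $(A,B)$ in which $A$ has the law of $J\cap X_\alpha$, $B$ has law $\mu_p$, and $A\subseteq B$ almost surely. In particular, this holds with $\alpha=1/2$, for every integer $N\ge1$, every $p\in(0,1)$, and every random set $J\subseteq[N]$ whose law is $\tfrac12 p$-spread.
   Context: $[N]=\{1,\dots,N\}$. For $0<s<1$, $\mu_s$ is the product probability measure on $2^{[N]}$ given by $\mu_s(A)=s^{|A|}(1-s)^{N-|A|}$ for $A\subseteq[N]$. A probability measure $\nu$ on $2^{[N]}$ is $q$-spread if a random set $J\sim\nu$ satisfies $\mathbb{P}(I\subseteq J)\le q^{|I|}$ for all $I\subseteq[N]$; a random set is called $q$-spread if its law is. For random sets $Y,Z\subseteq[N]$, $Y\le_d Z$ means that there exists a coupling $(A,B)$ of the laws of $Y$ and $Z$ (i.e. $A$ has the law of $Y$ and $B$ has the law of $Z$) with $A\subseteq B$ almost surely. *)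

(* Defs.v *)
From HB Require Import structures.
From mathcomp Require Import all_boot all_order all_algebra.
From mathcomp Require Import all_classical all_reals all_analysis.

Set Implicit Arguments.
Unset Strict Implicit.
Unset Printing Implicit Defensive.

Import Order.TTheory GRing.Theory Num.Theory.

Local Open Scope classical_set_scope.
Local Open Scope ring_scope.

(* The finite space 2^T carries the discrete sigma-algebra, so that a random
   subset of [N] is a random variable with values in {set 'I_N}. *)
Section discrete_powerset.
Variable T : finType.

HB.instance Definition _ := isPointed.Build {set T} finset.set0.

HB.instance Definition _ := @isMeasurable.Build default_measure_display
  {set T} discrete_measurable discrete_measurable0
  discrete_measurableC discrete_measurableU.

End discrete_powerset.

Section random_set_intersection.
Context d (Omega : measurableType d) (R : realType) (P : probability Omega R).
Context (N : nat) (Y Z : {RV P >-> {set 'I_N}}).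

Definition rset_cap : Omega -> {set 'I_N} := fun w => Y w :&: Z w.

Lemma measurable_rset_cap : measurable_fun [set: Omega] rset_cap.
Proof.
move=> _ U _; rewrite setTI.
have -> : rset_cap @^-1` U =
    \bigcup_(A in [set: {set 'I_N}]) \bigcup_(B in [set: {set 'I_N}])
      (if (A :&: B)%SET \in U then (Y @^-1` [set A] `&` Z @^-1` [set B])%classic
       else classical_sets.set0).
  apply/seteqP; split => [w Uw|w [A _ [B _]]].
    exists (Y w) => //; exists (Z w) => //.
    by rewrite ifT ?inE.
  by case: ifPn => //; rewrite inE => UAB [/= YA ZB]; rewrite /rset_cap /= YA ZB.
apply: fin_bigcup_measurable => [|A _]; first exact: finite_finset.
apply: fin_bigcup_measurable => [|B _]; first exact: finite_finset.
case: ifPn => _; last exact: measurable0.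
by apply: measurableI; exact: measurable_funPTI.
Qed.

HB.instance Definition _ :=
  isMeasurableFun.Build _ _ Omega {set 'I_N} rset_cap measurable_rset_cap.

End random_set_intersection.

(* s^|A| (1-s)^(N-|A|), the mass given to the subset A of [N] by the law of the
   random set containing each point independently with probability s. *)
Definition mu_pmf (R : nzRingType) (N : nat) (s : R) (A : {set 'I_N}) : R :=
  s ^+ #|A| * (1 - s) ^+ (N - #|A|).

(* The parameter is meant to lie in ]0, 1[; outside [0, 1] a junk value makes
   this a probability measure anyway, as for the library's bernoulli_prob. *)
Definition mu (R : realType) (N : nat) (s : R) : set {set 'I_N} -> \bar R :=
  fun U => if 0 <= s <= 1 then (\sum_(A \in U) (mu_pmf s A)%:E)%E
           else (\d_(finset.set0 : {set 'I_N}) U)%E.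

Section mu_is_probability.
Context (R : realType) (N : nat) (s : R).
Local Notation mu := (@mu R N s).

Lemma mu_pmf_ge0 (A : {set 'I_N}) : 0 <= s <= 1 -> 0 <= mu_pmf s A.
Proof.
by move=> /andP[s0 s1]; rewrite mulr_ge0// exprn_ge0// subr_ge0.
Qed.

Lemma sum_mu_pmf : \sum_(A : {set 'I_N}) mu_pmf s A = 1.
Proof.
transitivity (\prod_(i < N) (s + (1 - s))); last first.
  by rewrite big1// => i _; rewrite subrKC.
rewrite bigA_distr/=; apply: eq_bigr => A _.
rewrite (bigID (mem A))/= [X in X * _](eq_bigr (fun=> s)); last first.
  by move=> i ->.
rewrite [X in _ * X](eq_bigr (fun=> 1 - s)); last by move=> i /negPf ->.
rewrite !prodr_const /mu_pmf; congr (_ * _ ^+ _).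
by rewrite -[X in (X - _)%N]card_ord -(cardC A) addKn.
Qed.

Let mu0 : mu classical_sets.set0 = 0%E.
Proof. by rewrite /mu; case: ifPn => // _; rewrite fsbig_set0. Qed.

Let mu_ge0 U : (0 <= mu U)%E.
Proof.
rewrite /mu; case: ifPn => // s01.
rewrite fsbig_finite//= sumEFin lee_fin.
by apply: sumr_ge0 => /= b _; exact: mu_pmf_ge0.
Qed.

Let mu_sigma_additive : semi_sigma_additive mu.
Proof.
move=> F mF tF mUF; rewrite /mu; case: ifPn => s01; last first.
  exact: measure_semi_sigma_additive.
apply: cvg_toP.
  apply: ereal_nondecreasing_is_cvgn => m n mn.
  apply: lee_sum_nneg_natr => // k _ _.
  rewrite fsbig_finite//= sumEFin lee_fin.
  by apply: sumr_ge0 => /= b _; exact: mu_pmf_ge0.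
transitivity (\sum_(0 <= i <oo) (\esum_(j in F i) (mu_pmf s j)%:E))%E.
  apply: eq_eseriesr => k _; rewrite esum_fset//= => b _.
  by rewrite lee_fin mu_pmf_ge0.
rewrite -nneseries_sum_bigcup//=; last first.
  by move=> b; rewrite lee_fin mu_pmf_ge0.
by rewrite esum_fset//= => b _; rewrite lee_fin mu_pmf_ge0.
Qed.

HB.instance Definition _ := isMeasure.Build _ _ _ mu
  mu0 mu_ge0 mu_sigma_additive.

Let mu_setT : mu [set: _] = 1%E.
Proof.
rewrite /mu; case: ifPn => s01; last by rewrite diracT.
have -> : [set: {set 'I_N}] = [set` index_enum {set 'I_N}].
  by apply/seteqP; split => A // _; rewrite /= mem_index_enum.
by rewrite -fsbig_seq ?index_enum_uniq// sumEFin sum_mu_pmf.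
Qed.

HB.instance Definition _ := @Measure_isProbability.Build _ _ R mu mu_setT.

Lemma mu_set1 (A : {set 'I_N}) : 0 <= s <= 1 -> mu [set A] = (mu_pmf s A)%:E.
Proof. by move=> s01; rewrite /mu s01 fsbig_set1. Qed.

End mu_is_probability.

Definition spread (R : realType) (N : nat) (q : R)
    (nu : probability {set 'I_N} R) : Prop :=
  forall I : {set 'I_N}, (nu [set K | I \subset K] <= (q ^+ #|I|)%:E)%E.

Definition independent_RVs d d1 d2 (Omega : measurableType d)
    (T1 : measurableType d1) (T2 : measurableType d2) (R : realType)
    (P : probability Omega R) (Y : {RV P >-> T1}) (Z : {RV P >-> T2}) : Prop :=
  forall (U : set T1) (V : set T2), measurable U -> measurable V ->
    P (Y @^-1` U `&` Z @^-1` V) = (P (Y @^-1` U) * P (Z @^-1` V))%E.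

(* The order Y <=_d Z on random sets depends only on their laws, so it is
   defined on these. *)
Definition stoch_le (R : realType) (N : nat)
    (nu1 nu2 : probability {set 'I_N} R) : Prop :=
  exists (d : measure_display) (Omega : measurableType d)
    (P : probability Omega R) (A B : {RV P >-> {set 'I_N}}),
    [/\ distribution P A = nu1 :> (set {set 'I_N} -> \bar R),
        distribution P B = nu2 :> (set {set 'I_N} -> \bar R) &
        {ae P, forall w, A w \subset B w}].

(* Main.v *)
(* By finite Strassen duality it suffices to bound P(J :&: X \in F) by mu_p(F)
   for every upset F.  Write a_B(s) for the mixed difference of the indicator
   of F along B, averaged over the product measure with marginals s (the
   s-biased Fourier coefficient, up to scaling).  Monotonicity of F gives
     sum_B prod_(i in B) s_i (1 - t_i) * a_B(s) a_B(t) = mu_s(F)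
   for all s and t.  With s = alpha on K and 0 off K, and t = p constant,
   expanding
     0 <= sum_B prod_(i in B) s_i (1 - s_i) *
                 (a_B(s) - ((1 - p) / (1 - alpha))^|B| a_B(t))^2
   bounds P(K :&: X \in F) by a combination of the indicators of B \subset K
   with nonnegative coefficients (alpha (1 - p)^2 / (1 - alpha))^|B| a_B(p)^2.
   Averaging over K = J, spreadness and alpha^2 <= 1 - alpha turn this into at
   most sum_B (p (1 - p))^|B| a_B(p)^2, which is mu_p(F) again. *)

Require Import Defs.
From HB Require Import structures.
From mathcomp Require Import all_boot all_order all_algebra.
From mathcomp Require Import all_classical all_reals all_analysis.
From mathcomp Require Import lra.

Set Implicit Arguments.
Unset Strict Implicit.
Unset Printing Implicit Defensive.

Import Order.TTheory GRing.Theory Num.Theory.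

Local Open Scope ring_scope.

(** * Mixed differences under product measures and the upset inequality *)

Section BiasedFourier.
Variables (R : realFieldType) (T : finType).
Implicit Types (s t : T -> R) (A B K S : {set T}) (f : {set T} -> bool).

Definition prod_weight s S : R := \prod_i (if i \in S then s i else 1 - s i).

(** Signs of a discrete difference on [B], Bernoulli weights off [B]: [diff_coef f s B] is the
    a_B(s) of the overview, up to scaling the biased Fourier coefficient. *)
Definition diff_weight s B S : R :=
  \prod_i (if i \in B then (if i \in S then 1 else -1)
           else (if i \in S then s i else 1 - s i)).

Definition diff_coef f s B : R := \sum_(S : {set T}) diff_weight s B S * (f S)%:R.

Lemma prod_weight_ge0 s S : (forall i, 0 <= s i <= 1) -> 0 <= prod_weight s S.
Proof.
move=> s01; apply: prodr_ge0 => i _; have /andP[s0 s1] := s01 i.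
by case: ifP => // _; rewrite subr_ge0.
Qed.

(* Summing over B first leaves the weights k of a signed coupling of the two
   product measures that is carried by the pairs S \subset A; on these
   f S && f A = f S. *)
Lemma sum_diff_coefM f s t :
    (forall S A, S \subset A -> f S -> f A) ->
  \sum_(B : {set T}) (\prod_(i in B) (s i * (1 - t i))) * (diff_coef f s B * diff_coef f t B)
  = \sum_(S : {set T}) prod_weight s S * (f S)%:R.
Proof.
move=> fmono.
pose k i (x a : bool) : R :=
  if x then (if a then s i else 0) else (if a then t i - s i else 1 - t i).
transitivity (\sum_(S : {set T}) \sum_(A : {set T}) (\prod_i k i (i \in S) (i \in A)) *
                ((f S)%:R * (f A)%:R)).
  under eq_bigr => B _.
    rewrite /diff_coef big_distrlr mulr_sumr /=.
    under eq_bigr => S _ do rewrite mulr_sumr.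
    over.
  rewrite exchange_big; apply: eq_bigr => S _ /=.
  rewrite exchange_big; apply: eq_bigr => A _ /=.
  pose g (x : bool) : R := if x then 1 else -1.
  pose w (r : T -> R) i (x : bool) : R := if x then r i else 1 - r i.
  transitivity (\sum_(B : {set T}) (\prod_i (if i \in B then
      s i * (1 - t i) * (g (i \in S) * g (i \in A))
      else w s i (i \in S) * w t i (i \in A))) * ((f S)%:R * (f A)%:R)).
    apply: eq_bigr => B _.
    rewrite [X in X * _]big_mkcond /diff_weight /=.
    rewrite mulrACA [LHS]mulrA; congr (_ * _); rewrite -!big_split /=.
    by apply: eq_bigr => i _; case: (i \in B); rewrite ?mul1r.
  rewrite -mulr_suml -bigA_distr; congr (_ * _); apply: eq_bigr => i _.
  by rewrite /k /g /w; case: (i \in S); case: (i \in A) => /=; lra.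
apply: eq_bigr => S _.
transitivity (\sum_(A : {set T}) (\prod_i k i (i \in S) (i \in A)) * (f S)%:R).
  apply: eq_bigr => A _.
  have [SA|/subsetPn[i iS iNA]] := boolP (S \subset A).
    case fS : (f S); last by rewrite mul0r mulr0.
    by rewrite (fmono _ _ SA fS) mulr1.
  by rewrite (bigD1 i) //= iS (negPf iNA) /k !mul0r.
rewrite -mulr_suml; congr (_ * _).
(* Coordinate by coordinate, summing [k] over its last argument gives [s i] or [1 - s i]: the first
   marginal of the signed coupling. *)
transitivity (\sum_(A : {set T}) \prod_i (if i \in A then k i (i \in S) true
                              else k i (i \in S) false)).
  by apply: eq_bigr => A _; apply: eq_bigr => i _; case: (i \in A).
rewrite -bigA_distr; apply: eq_bigr => i _ /=.
by rewrite /k; case: (i \in S) => /=; lra.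
Qed.

(** Intersection with a fixed [K] acts coordinatewise, so it sends a product measure to a product
    measure, with marginals killed off [K]. This is why the marginals [s] are allowed to vary with
    the coordinate. *)
Lemma prod_weight_setI (a : R) K (g : {set T} -> R) :
  \sum_(A : {set T}) prod_weight (fun=> a) A * g (A :&: K) =
  \sum_(S : {set T}) prod_weight (fun i => if i \in K then a else 0) S * g S.
Proof.
transitivity (\sum_(A : {set T}) \sum_(S : {set T}) prod_weight (fun=> a) A * (S == A :&: K)%:R * g S).
  apply: eq_bigr => A _; rewrite (bigD1 (A :&: K)) //= eqxx mulr1.
  by rewrite big1 ?addr0 // => S /negPf ->; rewrite mulr0 mul0r.
rewrite exchange_big; apply: eq_bigr => S _ /=; rewrite -mulr_suml; congr (_ * _).
(* The indicator of [S == A :&: K] is itself a product over coordinates, so [bigA_distr] applies to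
   the sum over [A]. *)
transitivity (\sum_(A : {set T}) \prod_i (if i \in A then a * ((i \in S) == (i \in K))%:R
                              else (1 - a) * (i \notin S)%:R)).
  apply: eq_bigr => A _; rewrite /prod_weight.
  have -> : (S == A :&: K)%:R =
      \prod_i ((i \in S) == (i \in A) && (i \in K))%:R :> R.
    have [->|] := eqVneq.
      by rewrite big1 // => i _; rewrite inE eqxx.
    move=> nSAK.
    have /existsP[i Hi] : [exists i, (i \in S) != (i \in A) && (i \in K)].
      rewrite -negb_forall; apply: contra nSAK => /forallP SAK.
      apply/eqP/finset.setP => i.
      by rewrite (eqP (SAK i)) inE.
    by rewrite (bigD1 i) //= (negPf Hi) mul0r.
  rewrite -big_split; apply: eq_bigr => i _ /=.
  by case: (i \in A) => //=; case: (i \in S).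
rewrite -bigA_distr; apply: eq_bigr => i _ /=.
by case: (i \in S); case: (i \in K) => /=; lra.
Qed.

Section Domination.
Variables (f : {set T} -> bool) (a p : R).
Hypothesis fmono : forall S A, S \subset A -> f S -> f A.
Hypotheses (a_ge0 : 0 <= a) (a_lt1 : a < 1).

Let b B := diff_coef f (fun=> p) B.

Lemma section_prob_le K :
  \sum_(A : {set T}) prod_weight (fun=> a) A * (f (A :&: K))%:R <=
  \sum_(B : {set T} | B \subset K)
     (a * (1 - p) ^+ 2 / (1 - a)) ^+ #|B| * b B ^+ 2.
Proof.
rewrite (prod_weight_setI a K (fun S => (f S)%:R)).
set s := (fun i : T => if i \in K then a else 0); set u := \sum_(S : {set T}) _.
have a1 : 1 - a != 0 by rewrite subr_eq0 eq_sym lt_eqF.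
(* A [B] that leaves [K] meets a coordinate where [s] is 0; this restricts all the sums below to
   [B \subset K]. *)
have prodK (h : R -> R) B : h 0 = 0 -> \prod_(i in B) h (s i) =
    if B \subset K then h a ^+ #|B| else 0.
  move=> h0; case: ifPn => [BK|/subsetPn[i iB iK]].
    rewrite -prodr_const; apply: eq_bigr => i iB.
    by rewrite /s (fintype.subsetP BK).
  by rewrite (bigD1 i) //= /s (negPf iK) h0 mul0r.
(* The value in [sum_diff_coefM] depends only on its first family of marginals, so [t = s] ([su])
   and [t = p] ([sp]) both give [u]. *)
have su : \sum_(B : {set T} | B \subset K)
    (a * (1 - a)) ^+ #|B| * diff_coef f s B ^+ 2 = u.
  rewrite /u -(sum_diff_coefM s s fmono) big_mkcond; apply: eq_bigr => B _.
  rewrite (prodK (fun x => x * (1 - x))) ?mul0r //.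
  by case: ifP => _; rewrite ?mul0r // expr2.
have sp : \sum_(B : {set T} | B \subset K)
    (a * (1 - p)) ^+ #|B| * (diff_coef f s B * b B) = u.
  rewrite /u -(sum_diff_coefM s (fun=> p) fmono) big_mkcond; apply: eq_bigr => B _.
  rewrite (prodK (fun x => x * (1 - p))) ?mul0r //.
  by case: ifP => _; rewrite ?mul0r.
(* The ratio [(1 - p) / (1 - a)] turns the weight [a * (1 - a)] into [a * (1 - p)], so the cross
   term of the square is [- 2 * u] by [sp]. *)
have : 0 <= \sum_(B : {set T} | B \subset K) (a * (1 - a)) ^+ #|B| *
    (diff_coef f s B - ((1 - p) / (1 - a)) ^+ #|B| * b B) ^+ 2.
  apply: sumr_ge0 => B _; apply: mulr_ge0; last exact: sqr_ge0.
  by rewrite exprn_ge0 // mulr_ge0 // subr_ge0 ltW.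
have -> : \sum_(B : {set T} | B \subset K) (a * (1 - a)) ^+ #|B| *
    (diff_coef f s B - ((1 - p) / (1 - a)) ^+ #|B| * b B) ^+ 2 =
  u - 2 * u + \sum_(B : {set T} | B \subset K)
     (a * (1 - p) ^+ 2 / (1 - a)) ^+ #|B| * b B ^+ 2.
  rewrite -{1}su -sp mulr_sumr -sumrB -big_split; apply: eq_bigr => B _ /=.
  have -> : a * (1 - p) = a * (1 - a) * ((1 - p) / (1 - a))
    by rewrite -mulrA [_ * (_ / _)]mulrC divfK.
  have -> : a * (1 - p) ^+ 2 / (1 - a) =
      a * (1 - a) * ((1 - p) / (1 - a)) * ((1 - p) / (1 - a)).
    by rewrite -[a * (1 - a) * _]mulrA [(1 - a) * _]mulrC divfK // expr2; lra.
  by rewrite !exprMn; lra.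
have -> : u - 2 * u = - u by lra.
by rewrite addrC subr_ge0.
Qed.

Lemma spread_section_le (nu : {set T} -> R) :
    0 <= p -> p <= 1 -> a ^+ 2 <= 1 - a -> (forall K, 0 <= nu K) ->
    (forall I : {set T}, \sum_(K : {set T} | I \subset K) nu K <= (a * p) ^+ #|I|) ->
  \sum_(K : {set T}) nu K * (\sum_(A : {set T}) prod_weight (fun=> a) A * (f (A :&: K))%:R) <=
  \sum_(A : {set T}) prod_weight (fun=> p) A * (f A)%:R.
Proof.
move=> p0 p1 a2 nu0 nuq.
have a1 : 0 < 1 - a by rewrite subr_gt0.
pose r (B : {set T}) := (a * (1 - p) ^+ 2 / (1 - a)) ^+ #|B| * b B ^+ 2.
have r0 B : 0 <= r B.
  rewrite /r; apply: mulr_ge0; last exact: sqr_ge0.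
  by rewrite exprn_ge0 // divr_ge0 ?(ltW a1) // mulr_ge0 ?sqr_ge0.
apply: (@le_trans _ _ (\sum_(K : {set T}) nu K * \sum_(B : {set T} | B \subset K) r B)).
  by apply: ler_sum => K _; apply: ler_wpM2l => //; exact: section_prob_le.
(* After exchanging the sums, [r B] is multiplied by the mass of the [K] containing [B], which
   spreadness bounds. *)
apply: (@le_trans _ _ (\sum_(B : {set T}) r B * (a * p) ^+ #|B|)).
  under eq_bigr => K _ do rewrite mulr_sumr.
  rewrite (exchange_big_dep predT) //=; apply: ler_sum => B _.
  under eq_bigr => K _ do rewrite mulrC.
  by rewrite -mulr_sumr; apply: ler_wpM2l.
(* With [s = t = p] the right-hand side becomes a sum over the same [B] with the same squares, so it
   remains to compare the bases of the powers. *)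
rewrite -(sum_diff_coefM (fun=> p) (fun=> p) fmono); apply: ler_sum => B _.
rewrite -/(b B) -expr2 prodr_const /r mulrAC -exprMn.
apply: ler_wpM2r; first exact: sqr_ge0.
have c0 : 0 <= p * (1 - p) ^+ 2 by rewrite mulr_ge0 ?sqr_ge0.
apply: lerXn2r; rewrite ?nnegrE.
- by rewrite !mulr_ge0 ?invr_ge0 ?subr_ge0 ?(ltW a1) ?(ltW a_lt1).
- by rewrite mulr_ge0 // subr_ge0.
(* The first factor is at most 1 by [a ^+ 2 <= 1 - a]; the second is at most [p * (1 - p)]. *)
have -> : a * (1 - p) ^+ 2 / (1 - a) * (a * p) =
    (a ^+ 2 / (1 - a)) * (p * (1 - p) ^+ 2) by lra.
apply: (@le_trans _ _ (1 * (p * (1 - p) ^+ 2))).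
  by apply: ler_wpM2r => //; rewrite ler_pdivrMr // mul1r.
by rewrite mul1r ler_wpM2l // expr2 ler_piMr ?subr_ge0 // lerBlDr lerDl.
Qed.

End Domination.
End BiasedFourier.

(** * Fractional Hall theorem for a finite relation *)

Section Transport.
Variables (R : realFieldType) (X Y : finType) (r : X -> Y -> bool).
Implicit Types (a : X -> R) (b : Y -> R) (S : {set X}).

Definition nbhd S : {set Y} := [set y | [exists x in S, r x y]].

Definition hall a b :=
  forall S, \sum_(x in S) a x <= \sum_(y in nbhd S) b y.

(** The second marginal is only bounded by [b], since the right side may carry more mass than the
    left, as in the subproblem off a tight set. *)
Definition transported a b := exists w : X -> Y -> R,
  [/\ forall x y, 0 <= w x y, forall x y, ~~ r x y -> w x y = 0,
      forall x, \sum_y w x y = a x & forall y, \sum_x w x y <= b y].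

Lemma nbhdU S1 S2 : nbhd (S1 :|: S2) = nbhd S1 :|: nbhd S2.
Proof.
apply/finset.setP => y; rewrite !inE; apply/existsP/orP.
  by move=> [x]; rewrite inE => /andP[/orP[xS|xS] rxy]; [left|right];
     apply/existsP; exists x; rewrite xS.
by move=> [] /existsP[x /andP[xS rxy]]; exists x; rewrite inE xS ?orbT.
Qed.

Lemma nbhdS S1 S2 : S1 \subset S2 -> nbhd S1 \subset nbhd S2.
Proof. by move=> /finset.setUidPr <-; rewrite nbhdU finset.subsetUl. Qed.

Lemma sum_restrict (I : finType) (c : I -> R) (S1 S2 : {set I}) :
  \sum_(i in S1) (if i \in S2 then c i else 0) = \sum_(i in S1 :&: S2) c i.
Proof. by rewrite -big_mkcondr; apply: eq_bigl => i; rewrite inE. Qed.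

Lemma sum_shift (I : finType) (c : I -> R) (e : R) (i0 : I) (S1 : {set I}) :
  \sum_(i in S1) (c i - e * (i == i0)%:R) = \sum_(i in S1) c i - e * (i0 \in S1)%:R.
Proof.
rewrite sumrB -mulr_sumr; congr (_ - _ * _).
have [i0S|i0S] := boolP (i0 \in S1).
  by rewrite (bigD1 i0) //= eqxx big1 ?addr0 // => i /andP[_ /negPf ->].
by rewrite big1 // => i iS; have [ii0|//] := eqVneq i i0; rewrite ii0 (negPf i0S) in iS.
Qed.

Lemma transported_split a b S :
    (forall x, 0 <= a x) -> (forall y, 0 <= b y) ->
  transported (fun x => if x \in S then a x else 0)
              (fun y => if y \in nbhd S then b y else 0) ->
  transported (fun x => if x \in ~: S then a x else 0)
              (fun y => if y \in ~: nbhd S then b y else 0) ->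
  transported a b.
Proof.
move=> a0 b0 [w1 [w10 w1r w1a w1b]] [w2 [w20 w2r w2a w2b]].
exists (fun x y => w1 x y + w2 x y); split.
- by move=> x y; rewrite addr_ge0.
- by move=> x y nr; rewrite w1r // w2r // addr0.
- by move=> x; rewrite big_split /= w1a w2a finset.in_setC; case: (x \in S); rewrite ?addr0 ?add0r.
- move=> y; rewrite big_split /=; apply: le_trans (lerD (w1b y) (w2b y)) _.
  by rewrite finset.in_setC; case: (y \in nbhd S); rewrite ?addr0 ?add0r.
Qed.

Lemma transported_push a b e x0 y0 : 0 <= e -> r x0 y0 ->
  transported (fun x => a x - e * (x == x0)%:R) (fun y => b y - e * (y == y0)%:R) ->
  transported a b.
Proof.
move=> e0 r0 [w [w0 wr wa wb]].
exists (fun x y => w x y + e * ((x == x0) && (y == y0))%:R); split.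
- by move=> x y; rewrite addr_ge0 // mulr_ge0.
- move=> x y nr; rewrite wr // add0r.
  by case: andP => [[/eqP xx0 /eqP yy0]|]; rewrite ?mulr0 // xx0 yy0 r0 in nr *.
- move=> x; rewrite big_split /= wa -mulr_sumr (bigD1 y0) //= eqxx andbT.
  by rewrite big1 ?addr0 ?subrK // => y /negPf ->; rewrite andbF.
- move=> y; rewrite big_split /= -mulr_sumr.
  rewrite [X in e * X](bigD1 x0) //= eqxx /=.
  rewrite [X in e * (_ + X)]big1 => [|x /negPf -> //].
  by rewrite addr0 -lerBrDr.
Qed.

(** Inside [S], use Hall's condition for [T :&: S], whose neighbours lie in both [nbhd T] and
    [nbhd S]. Outside, use it for [S :|: T] and cancel the tight equality for [S]. *)
Lemma hall_split a b S :
    (forall y, 0 <= b y) ->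
    hall a b -> \sum_(x in S) a x = \sum_(y in nbhd S) b y ->
  hall (fun x => if x \in S then a x else 0)
       (fun y => if y \in nbhd S then b y else 0) /\
  hall (fun x => if x \in ~: S then a x else 0)
       (fun y => if y \in ~: nbhd S then b y else 0).
Proof.
move=> b0 hab tight; split => T; rewrite !sum_restrict.
  apply: le_trans (hab _) _; rewrite [leRHS](bigID (mem (nbhd (T :&: S)))) /=.
  rewrite ler_wpDr ?sumr_ge0 // le_eqVlt; apply/orP; left; apply/eqP.
  apply: eq_bigl => y; rewrite [in RHS]inE andbC.
  case yN: (y \in nbhd (T :&: S)) => //=.
  by rewrite (fintype.subsetP (nbhdS (finset.subsetIl T S))) ?(fintype.subsetP (nbhdS (finset.subsetIr T S))).
have := hab (S :|: T); rewrite nbhdU.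
have sumU (I : finType) (c : I -> R) (U V : {set I}) :
    \sum_(i in U :|: V) c i = \sum_(i in U) c i + \sum_(i in V :&: ~: U) c i.
  rewrite (bigID (mem U)) /=; congr (_ + _); apply: eq_bigl => i; rewrite !inE.
    by case: (i \in U) => //=; rewrite andbF.
  by case: (i \in U) => //=; rewrite ?andbF ?andbT.
by rewrite !sumU tight lerD2l.
Qed.

Lemma card_supp_sub (I : finType) (c c' : I -> R) :
  (forall i, c i = 0 -> c' i = 0) -> (#|[set i | c' i != 0%R]| <= #|[set i | c i != 0%R]|)%N.
Proof.
move=> cc'; apply: subset_leq_card; apply/fintype.subsetP => i; rewrite !inE.
by apply: contra => /eqP /cc' ->.
Qed.

Lemma card_supp_proper (I : finType) (c c' : I -> R) i :
  (forall i, c i = 0 -> c' i = 0) -> c i != 0 -> c' i = 0 ->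
  (#|[set i | c' i != 0%R]| < #|[set i | c i != 0%R]|)%N.
Proof.
move=> cc' ci c'i; apply: proper_card; apply/fintype.properP; split.
  by apply/fintype.subsetP => j; rewrite !inE; apply: contra => /eqP /cc' ->.
by exists i; rewrite inE // c'i eqxx.
Qed.

(* Halmos-Vaughan: mass is moved along one edge until either a vertex is
   exhausted or Hall's condition becomes tight for some set, in which case the
   problem splits into two smaller ones. *)
Theorem hall_transported a b :
  (forall x, 0 <= a x) -> (forall y, 0 <= b y) -> hall a b -> transported a b.
Proof.
(* The induction is on the number of points of nonzero mass on the two sides together. *)
have [n] := ubnP (#|[set x | a x != 0%R]| + #|[set y | b y != 0%R]|)%N.
elim: n a b => // n IH a b ltn a0 b0 hab.
have [a_eq0|] := boolP [forall x, a x == 0].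
  exists (fun _ _ => 0); split => // [x|y]; rewrite big1 //.
  by apply/esym/eqP/(forallP a_eq0).
rewrite negb_forall => /existsP[x0 ax0].
have [y0 r0 by0] : exists2 y0, r x0 y0 & b y0 != 0.
  apply/exists_inP; apply: contraT => /exists_inPn nb.
  have := hab [set x0]; rewrite big_set1 big1 => [|y].
    by rewrite le_eqVlt (negPf ax0) ltNge a0.
  rewrite inE => /exists_inP[x /finset.set1P -> rxy].
  by apply/eqP; rewrite -[_ == _]negbK nb.
pose slack S := \sum_(y in nbhd S) b y - \sum_(x in S) a x.
(* Moving mass along the edge from [x0] to [y0] lowers the slack of exactly these sets: if
   [x0 \in S], both sides lose the same amount. *)
pose crossing S := (x0 \notin S) && (y0 \in nbhd S).
pose a' e x := a x - e * (x == x0)%:R.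
pose b' e y := b y - e * (y == y0)%:R.
have slack0 S : 0 <= slack S by rewrite subr_ge0.
have x0N S : x0 \in S -> y0 \in nbhd S.
  by move=> xS; rewrite inE; apply/exists_inP; exists x0.
have hall' e : 0 <= e -> (forall S, crossing S -> e <= slack S) ->
    hall (a' e) (b' e).
  move=> e0 ecross S; rewrite !sum_shift.
  have := hab S; have := ecross S; rewrite /crossing /slack.
  have := @x0N S.
  case: (x0 \in S) => [->|_] //=; first by rewrite lerD2r.
  case: (y0 \in nbhd S) => [/(_ isT)|_]; rewrite ?mulr0 ?subr0 // mulr1.
  by move=> ? _; rewrite lerBrDr -lerBrDl.
have a'0 e x : 0 <= e <= a x0 -> 0 <= a' e x.
  by move=> /andP[_ ea]; rewrite /a'; have [->|_] := eqVneq x x0;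
     rewrite subr_ge0 ?mulr1 ?mulr0.
have b'0 e y : 0 <= e <= b y0 -> 0 <= b' e y.
  by move=> /andP[_ eb]; rewrite /b'; have [->|_] := eqVneq y y0;
     rewrite subr_ge0 ?mulr1 ?mulr0.
have supp_a' e x : a x = 0 -> a' e x = 0.
  move=> ax; rewrite /a' ax; have [xx0|_] := eqVneq x x0; last by rewrite mulr0 subr0.
  by rewrite -xx0 ax eqxx in ax0.
have supp_b' e y : b y = 0 -> b' e y = 0.
  move=> bY; rewrite /b' bY; have [yy0|_] := eqVneq y y0; last by rewrite mulr0 subr0.
  by rewrite -yy0 bY eqxx in by0.
have [min_a min_b] : Num.min (a x0) (b y0) <= a x0 /\ Num.min (a x0) (b y0) <= b y0.
  by rewrite !ge_min !lexx orbT.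
have min0 : 0 <= Num.min (a x0) (b y0) by rewrite le_min a0 b0.
(* If no crossing set obstructs, moving the minimum empties [x0] or [y0] and the support shrinks. *)
have [/existsP[S1 /andP[cS1 sS1]]|nobad] :=
    boolP [exists S, crossing S && (slack S < Num.min (a x0) (b y0))]; last first.
  apply: (@transported_push _ _ (Num.min (a x0) (b y0)) x0 y0) => //.
  apply: IH.
  - rewrite ltnS in ltn; apply: leq_trans ltn.
    have [ab|ba] := leP (a x0) (b y0).
    + rewrite -addSn leq_add ?card_supp_sub //; last exact: supp_b'.
      apply: (@card_supp_proper _ a _ x0) => //; first exact: supp_a'.
      by rewrite eqxx mulr1 subrr.
    + rewrite -addnS leq_add ?card_supp_sub //; first exact: supp_a'.
      apply: (@card_supp_proper _ b _ y0) => //; first exact: supp_b'.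
      by rewrite eqxx mulr1 subrr.
  - by move=> x; apply: a'0; rewrite min0.
  - by move=> y; apply: b'0; rewrite min0.
  - apply: hall' => // S cS; rewrite leNgt; apply: contra nobad => sS.
    by apply/existsP; exists S; rewrite cS.
(* Moving the least crossing slack keeps Hall's condition and makes its minimizer [S] tight. *)
have [S cS Smin] := @arg_minP _ R _ S1 crossing slack cS1.
have sS : slack S < Num.min (a x0) (b y0) := le_lt_trans (Smin _ cS1) sS1.
have [sa sb] := (ltW (lt_le_trans sS min_a), ltW (lt_le_trans sS min_b)).
have /andP[x0S y0S] := cS.
pose e := slack S.
have hab' : hall (a' e) (b' e) by apply: hall' (slack0 S) _ => T; exact: Smin.
have a'e0 x : 0 <= a' e x by apply: a'0; rewrite slack0.
have b'e0 y : 0 <= b' e y by apply: b'0; rewrite slack0.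
have tight : \sum_(x in S) a' e x = \sum_(y in nbhd S) b' e y.
  by rewrite !sum_shift (negPf x0S) y0S mulr0 mulr1 /e /slack; lra.
(* Without mass in [S], its slack would be at least [b y0]. The part on [S] loses [x0] from its
   support and the part on the complement loses [x1], so both are smaller. *)
have [x1 x1S ax1] : exists2 x, x \in S & a x != 0.
  apply/exists_inP; apply: contraT => /exists_inPn aS.
  move: sS; rewrite ltNge (le_trans min_b) // /slack [X in _ - X]big1 => [|x xS].
    by rewrite subr0 (bigD1 y0) //= lerDl sumr_ge0.
  by apply/eqP; rewrite -[_ == _]negbK aS.
apply: (@transported_push _ _ e x0 y0) => //; first exact: slack0.
have [h1 h2] := hall_split b'e0 hab' tight.
have supp_b (S2 : {set Y}) :
  (#|[set y | (if y \in S2 then b' e y else 0%R) != 0%R]| <=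
    #|[set y | b y != 0%R]|)%N.
  by apply: card_supp_sub => y bY; rewrite supp_b' // if_same.
apply: (@transported_split _ _ S) => //; apply: IH => //.
- rewrite ltnS in ltn; apply: leq_trans ltn; rewrite -addSn leq_add ?supp_b //.
  apply: (@card_supp_proper _ a _ x0) => //=; last by rewrite (negPf x0S).
  by move=> x ax; case: ifP => // _; exact: supp_a'.
- by move=> x; case: ifP => // _; exact: a'e0.
- by move=> y; case: ifP => // _; exact: b'e0.
- rewrite ltnS in ltn; apply: leq_trans ltn; rewrite -addSn leq_add ?supp_b //.
  apply: (@card_supp_proper _ a _ x1) => //=; last by rewrite finset.in_setC x1S.
  by move=> x ax; case: ifP => // _; exact: supp_a'.
- by move=> x; case: ifP => // _; exact: a'e0.
- by move=> y; case: ifP => // _; exact: b'e0.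
Qed.

End Transport.

(** * Laws on finite spaces *)

Lemma fine_preimage_sum d (Omega : measurableType d) (R : realType)
    (P : probability Omega R) (I : finType) (g : Omega -> I) (V : pred I) :
    (forall i, measurable (g @^-1` [set i])%classic) ->
  fine (P (g @^-1` [set i | V i])%classic) =
  \sum_(i | V i) fine (P (g @^-1` [set i])%classic).
Proof.
move=> mg.
have -> : (g @^-1` [set i | V i] = \bigcup_(i in [set i | V i]) g @^-1` [set i])%classic.
  by apply/seteqP; split => [w Vw|w [i /= Vi gw]] /=; [exists (g w)|rewrite gw].
rewrite measure_fin_bigcup //; last first.
- by move=> i j _ _ [w [/= <- <-]].
- exact: finite_finset.
have -> : [set i | V i]%classic = [set` [seq i <- index_enum I | V i]]%classic.
  by apply/seteqP; split => i /=; rewrite mem_filter mem_index_enum andbT.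
rewrite -fsbig_seq ?filter_uniq ?index_enum_uniq // big_filter -sum_fine //.
by move=> i _; rewrite fin_num_measure.
Qed.

Section FiniteProbability.
Context d (T : measurableType d) (R : realType) (n : nat).
Variables (w : 'I_n -> R) (e : 'I_n -> T).
Hypotheses (w_ge0 : forall i, 0 <= w i) (w_sum1 : \sum_i w i = 1).

(** [msum] takes a sequence indexed by [nat], so the atoms and weights on ['I_n] are extended
    through [insub]. *)
Let pt (i : nat) : T := if insub i is Some j then e j else point.
Let wt (i : nat) : {nonneg R} :=
  if insub i is Some j then NngNum (w_ge0 j) else 0%:nng.

Definition atomic_prob : set T -> \bar R :=
  msum (fun i => mscale (wt i) \d_(pt i)) n.

HB.instance Definition _ := Measure.on atomic_prob.

Lemma atomic_probE U : atomic_prob U = (\sum_(i | e i \in U) w i)%:E.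
Proof.
rewrite /atomic_prob /msum [in RHS]big_mkcond -sumEFin; apply: eq_bigr => i _.
transitivity ((wt i)%:num%:E * (\1_U (pt i))%:E)%E => //.
rewrite indicE /wt /pt valK /=.
by case: (e i \in U); rewrite ?mule1 ?mule0.
Qed.

Let atomic_prob_setT : atomic_prob setT = 1%E.
Proof.
by rewrite atomic_probE; under eq_bigl do rewrite in_setT; rewrite w_sum1.
Qed.

HB.instance Definition _ :=
  @Measure_isProbability.Build _ _ R atomic_prob atomic_prob_setT.

Definition atomic_probability : probability T R := atomic_prob.

End FiniteProbability.

Lemma mu_pmfE (R : realFieldType) (N : nat) (s : R) (A : {set 'I_N}) :
  mu_pmf s A = prod_weight (fun=> s) A.
Proof.
rewrite /prod_weight (bigID (mem A)) /=.
rewrite [X in X * _](eq_bigr (fun=> s)) => [|i -> //].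
rewrite [X in _ * X](eq_bigr (fun=> 1 - s)) => [|i /negPf -> //].
rewrite !prodr_const /mu_pmf; congr (_ * _ ^+ _).
by rewrite -[X in (X - _)%N]card_ord -(cardC A) addKn.
Qed.

Lemma eq_powerset_prob (R : realType) (N : nat)
    (m1 m2 : probability {set 'I_N} R) :
    (forall A, fine (m1 [set A]) = fine (m2 [set A]))%classic ->
  m1 = m2 :> (set {set 'I_N} -> \bar R).
Proof.
move=> m12; apply/funext => U.
have m_fine (m : probability {set 'I_N} R) :
    m U = (\sum_(A | A \in U) fine (m [set A]%classic))%:E.
  rewrite -(@fine_preimage_sum _ _ _ m _ id (fun A => A \in U)) //.
  rewrite fineK ?fin_num_measure // preimage_id; congr (m _).
  by apply/seteqP; split => A /=; rewrite inE.
by rewrite !m_fine; congr (_%:E); apply: eq_bigr.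
Qed.

(** Conditioning on [J]: by independence the pair [(J, X)] has a product law, and the event is split
    over the values of this pair. *)
Lemma cap_law (d : measure_display) (Omega : measurableType d) (R : realType)
    (P : probability Omega R) (N : nat) (J X : {RV P >-> {set 'I_N}}) (a : R)
    (V : pred {set 'I_N}) :
    0 <= a <= 1 -> distribution P X = mu a :> (set {set 'I_N} -> \bar R) ->
    independent_RVs J X ->
  \sum_(A | V A) fine (distribution P (rset_cap J X) [set A]%classic) =
  \sum_(K : {set 'I_N}) fine (distribution P J [set K]%classic) *
    (\sum_(A : {set 'I_N}) prod_weight (fun=> a) A * (V (A :&: K))%:R).
Proof.
move=> a01 Xa JX.
pose g w := (J w, X w).
have gE KA : (g @^-1` [set KA] = J @^-1` [set KA.1] `&` X @^-1` [set KA.2])%classic.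
  apply/seteqP; split => w; first by move=> /= <-.
  by case: KA => K A [/= <- <-].
have mg KA : measurable (g @^-1` [set KA])%classic.
  by rewrite gE; apply: measurableI; exact: measurable_funPTI.
rewrite -(@fine_preimage_sum _ _ _ P _ (rset_cap J X)); last first.
  by move=> A; exact: measurable_funPTI.
transitivity (fine (P (g @^-1` [set KA | V (KA.2 :&: KA.1)])%classic)).
  congr (fine (P _)); apply/seteqP.
  by split => w /=; rewrite /rset_cap /= finset.setIC.
rewrite (@fine_preimage_sum _ _ _ P _ g (fun KA => V (KA.2 :&: KA.1))) //.
under [RHS]eq_bigr do rewrite mulr_sumr.
rewrite pair_bigA big_mkcond /=; apply: eq_bigr => -[K A] _ /=.
have -> : fine (P (g @^-1` [set (K, A)])%classic) =
    fine (distribution P J [set K]%classic) * prod_weight (fun=> a) A.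
  have fin_law (Y : {RV P >-> {set 'I_N}}) U : P (Y @^-1` U)%classic \is a fin_num.
    by apply: fin_num_measure; exact: measurable_funPTI.
  rewrite gE /= JX // fineM ?fin_law //; congr (_ * _).
  by rewrite -mu_pmfE -[RHS]/(fine (mu_pmf a A)%:E) -mu_set1 // -Xa.
by case: (V _); rewrite ?mulr1 ?mulr0.
Qed.

(** * Construction of the monotone coupling *)

Theorem spread_cap_stoch_le (d : measure_display) (Omega : measurableType d)
    (R : realType) (P : probability Omega R) (N : nat)
    (J X : {RV P >-> {set 'I_N}}) (a p : R) :
    0 <= a -> a < 1 -> a ^+ 2 <= 1 - a -> 0 <= p -> p <= 1 ->
    spread (a * p) (distribution P J) ->
    distribution P X = mu a :> (set {set 'I_N} -> \bar R) ->
    independent_RVs J X ->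
  stoch_le (distribution P (rset_cap J X)) (mu p).
Proof.
move=> a0 a1 a2 p0 p1 Jq Xa JX.
have a01 : 0 <= a <= 1 by rewrite a0 ltW.
have p01 : 0 <= p <= 1 by rewrite p0.
pose rho (A : {set 'I_N}) := fine (distribution P (rset_cap J X) [set A]%classic).
have rho0 A : 0 <= rho A by exact: fine_ge0.
pose r (A B : {set 'I_N}) := A \subset B.
have hall_rho : hall r rho (prod_weight (fun=> p)).
  (* For inclusion, [nbhd r S] is the upset generated by [S]. It contains [S], so Hall's condition
     follows from the bound for upsets. *)
  move=> S; pose f B := B \in nbhd r S.
  have fmono (A B : {set 'I_N}) : A \subset B -> f A -> f B.
    move=> AB; rewrite /f !inE => /exists_inP[C CS CA].
    by apply/exists_inP; exists C => //; exact: fintype.subset_trans AB.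
  apply: (@le_trans _ _ (\sum_(A | f A) rho A)).
    rewrite [leRHS](bigID (mem S)) /= ler_wpDr ?sumr_ge0 //.
    rewrite le_eqVlt; apply/orP; left; apply/eqP; apply: eq_bigl => A.
    case AS: (A \in S); rewrite ?andbF // andbT /f inE.
    by apply/esym/exists_inP; exists A => //; exact: fintype.subxx.
  rewrite (cap_law _ a01 Xa JX).
  apply: le_trans (spread_section_le fmono a0 a1 p0 p1 a2 _ _) _.
  - by move=> K; exact: fine_ge0.
  - move=> I.
    rewrite -(@fine_preimage_sum _ _ _ P _ J (fun K => I \subset K)); last first.
      by move=> K; exact: measurable_funPTI.
    rewrite -lee_fin fineK; first exact: Jq.
    by apply: fin_num_measure; exact: measurable_funPTI.
  - rewrite [leRHS]big_mkcond; apply: ler_sum => A _.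
    by rewrite -/(f A); case: (f A); rewrite ?mulr1 ?mulr0.
have [|W [W0 Wr WA WB]] := hall_transported rho0 _ hall_rho.
  by move=> B; exact: prod_weight_ge0.
have Wsum : \sum_A \sum_B W A B = 1.
  under eq_bigr do rewrite WA.
  rewrite -(@fine_preimage_sum _ _ _ P _ (rset_cap J X) predT).
    rewrite (_ : (_ @^-1` _)%classic = setT) ?probability_setT //.
    by apply/seteqP.
  by move=> A; exact: measurable_funPTI.
(* The second marginal lies below [mu_pmf p] pointwise and both have total mass 1, so they agree. *)
have WBE B : \sum_A W A B = mu_pmf p B.
  apply/esym/eqP; rewrite mu_pmfE -subr_eq0.
  have /psumr_eq0P -> // : forall B, true -> 0 <= prod_weight (fun=> p) B - \sum_A W A B.
    by move=> C _; rewrite subr_ge0.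
  rewrite sumrB -[X in _ - X]exchange_big /= Wsum.
  by under eq_bigr do rewrite -mu_pmfE; rewrite sum_mu_pmf subrr.
pose T := ({set 'I_N} * {set 'I_N})%type.
(* The coupling lives on pairs of sets, enumerated to fit the ordinal indices of
   [atomic_probability]; [A] and [B] are the projections. *)
pose w (i : 'I_#|{: T}|) := W (enum_val i).1 (enum_val i).2.
have sum_w (V : pred T) : \sum_(i : 'I_#|{: T}| | V (enum_val i)) w i =
    \sum_A \sum_B (if V (A, B) then W A B else 0).
  rewrite pair_bigA (reindex (enum_val : 'I_#|{: T}| -> T)) /=.
    rewrite big_mkcond; apply: eq_bigr => i _.
    by rewrite /w; case: (enum_val i).
  exact: onW_bij (enum_val_bij _).
have w0 i : 0 <= w i by exact: W0.
have w1 : \sum_i w i = 1 by rewrite (sum_w predT) /= Wsum.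
pose Q := atomic_probability (enum_val : 'I_#|{: T}| -> T) w0 w1.
have QE U : Q U = (\sum_A \sum_B (if (A, B) \in U then W A B else 0))%:E.
  by rewrite /Q /= atomic_probE (sum_w (fun AB => AB \in U)).
pose A : {RV Q >-> {set 'I_N}} := HB.pack (fst : T -> {set 'I_N})
  (isMeasurableFun.Build _ _ _ _ (fst : T -> {set 'I_N}) measurable_fst).
pose B : {RV Q >-> {set 'I_N}} := HB.pack (snd : T -> {set 'I_N})
  (isMeasurableFun.Build _ _ _ _ (snd : T -> {set 'I_N}) measurable_snd).
exists _, T, Q, A, B; split.
- apply: eq_powerset_prob => C; rewrite -/(rho C) -WA /=.
  rewrite /pushforward QE /= (bigD1 C) //= [X in _ + X]big1 ?addr0.
    by apply: eq_bigr => D _; rewrite ifT // inE.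
  move=> C' CC'; rewrite big1 // => D _; rewrite ifF //.
  by apply/negbTE; apply: contra CC'; rewrite inE /= => ->.
- apply: eq_powerset_prob => C; transitivity (mu_pmf p C); last first.
    by rewrite -[LHS]/(fine (mu_pmf p C)%:E) -mu_set1.
  rewrite -WBE /=.
  rewrite /pushforward QE /=; apply: eq_bigr => D _.
  rewrite (bigD1 C) //= ifT ?inE // big1 ?addr0 //.
  move=> C' CC'; rewrite ifF //.
  by apply/negbTE; apply: contra CC'; rewrite inE /= => ->.
- exists [set AB : T | ~~ (AB.1 \subset AB.2)]%classic; split.
  (* [T] carries the product sigma-algebra, so the exceptional set is written as a finite union of
     rectangles. *)
  + rewrite [X in measurable X](_ : _ = \bigcup_(AB in [set AB : T |
        ~~ (AB.1 \subset AB.2)]) ([set AB.1] `*` [set AB.2]))%classic.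
      apply: fin_bigcup_measurable => [|AB _]; first exact: finite_finset.
      by apply: measurableX.
    apply/seteqP; split => [[C D] CD|[C D] [[C' D'] /= CD [-> ->]]] //.
    by exists (C, D).
  + rewrite QE big1 // => C _; rewrite big1 // => D _.
    by case: ifP => //; rewrite inE /=; exact: Wr.
  + by move=> AB /= /negP.
Qed.

(** The bound g is the positive root of x^2 = 1 - x, so a^2 <= g^2 = 1 - g <= 1 - a; and g < 1
    because the root of 5 is below 3. *)
Lemma golden_sqr_le (R : rcfType) (a : R) :
  0 <= a -> a <= (Num.sqrt 5 - 1) / 2 -> a < 1 /\ a ^+ 2 <= 1 - a.
Proof.
move=> a0 ag; have s5 : Num.sqrt 5 ^+ 2 = 5 :> R by rewrite sqr_sqrtr.
have : a ^+ 2 <= ((Num.sqrt 5 - 1) / 2) ^+ 2.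
  by apply: lerXn2r; rewrite ?nnegrE // (le_trans a0).
have s3 : Num.sqrt 5 < 3 :> R.
  by rewrite -(@ltr_pXn2r _ 2) ?nnegrE // ?sqrtr_ge0 // s5; lra.
move=> a2; split; first lra.
apply: le_trans a2 _; rewrite expr2 in s5 *; lra.
Qed.

Theorem corollary1p3 (R : realType) :
  (forall alpha : R, 0 < alpha -> alpha <= (Num.sqrt 5 - 1) / 2 ->
   forall N : nat, (1 <= N)%N ->
   forall p : R, 0 < p -> p < 1 ->
   forall (d : measure_display) (Omega : measurableType d)
     (P : probability Omega R) (J X : {RV P >-> {set 'I_N}}),
   spread (alpha * p) (distribution P J) ->
   distribution P X = mu alpha :> (set {set 'I_N} -> \bar R) ->
   independent_RVs J X ->
   stoch_le (distribution P (rset_cap J X)) (mu p))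
  /\
  (forall N : nat, (1 <= N)%N ->
   forall p : R, 0 < p -> p < 1 ->
   forall (d : measure_display) (Omega : measurableType d)
     (P : probability Omega R) (J X : {RV P >-> {set 'I_N}}),
   spread (2^-1 * p) (distribution P J) ->
   distribution P X = mu 2^-1 :> (set {set 'I_N} -> \bar R) ->
   independent_RVs J X ->
   stoch_le (distribution P (rset_cap J X)) (mu p)).
Proof.
split=> [a a0 ag N _ p p0 p1 d Omega P J X|N _ p p0 p1 d Omega P J X].
  have [a1 a2] := golden_sqr_le (ltW a0) ag.
  by apply: spread_cap_stoch_le; rewrite ?(ltW a0) ?(ltW p0) ?(ltW p1).
(* For 1/2 the condition [a ^+ 2 <= 1 - a] reads 1/4 <= 1/2. *)
apply: spread_cap_stoch_le; rewrite ?(ltW p0) ?(ltW p1) //; lra.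
Qed.
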